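(* Let $M$ be the closed, Haken, hyperbolic 3-manifold m188(2,3), whose fundamental group is $$\pi_1(M)=\left\langle \alpha,\beta \;\middle|\; \alpha^3\beta^{-1}\alpha\beta^2\alpha\beta^2\alpha\beta^{-1},\ \ \alpha^{-2}\beta^3\alpha^{-2}\beta^3\alpha\beta^{-1}\alpha\beta^3\right\rangle .$$ Let $\mathbb{F}$ be an algebraically closed field of characteristic $p$. (i) If $p\neq2$, then the components of the variety of characters $X(M,\mathbb{F})$ that contain characters of irreducible representations consist of finitely many points, i.e. $\dim X^{\mathrm{irr}}(M,\mathbb{F})=0$. (ii) If $p=2$, then $X^{\mathrm{irr}}(M,\mathbb{F})$ contains a curve, and $\dim X^{\mathrm{irr}}(M,\mathbb{F})=1$. In particular, $X(M,\mathbb{F})$ contains a curve (and hence has ideal points, which detect essential surfaces in $M$) only when $\mathbb{F}$ has characteristic $2$.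
   Context: m188(2,3) denotes the Dehn filling with filling coefficients (2,3) of the one-cusped manifold m188 in the SnapPea census; for the algebraic assertions only the presentation of $\pi_1(M)$ is needed. For a finitely generated group $\Gamma$, $X(\Gamma,\mathbb{F})$ is the affine variety whose points are the characters $\gamma\mapsto \mathrm{tr}\,\rho(\gamma)$ of representations $\rho\colon\Gamma\to\mathrm{SL}_2(\mathbb{F})$, and $X(M,\mathbb{F})=X(\pi_1(M),\mathbb{F})$; since $\pi_1(M)=\langle\alpha,\beta\rangle$, it is identified with the set of triples $(\mathrm{tr}\,\rho(\alpha),\mathrm{tr}\,\rho(\beta),\mathrm{tr}\,\rho(\alpha\beta))\in\mathbb{F}^3$. A representation is irreducible if its image leaves no 1-dimensional subspace of $\mathbb{F}^2$ invariant, and $X^{\mathrm{irr}}(M,\mathbb{F})$ is the Zariski closure of the set of characters of irreducible representations. A curve is a 1-dimensional irreducible subvariety; its ideal points are the points added in passing to its smooth projective closure. *)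

(* Defs.v *)
From HB Require Import structures.
From mathcomp Require Import all_boot all_order all_algebra.
From mathcomp Require Import mpoly.

Set Implicit Arguments.
Unset Strict Implicit.
Unset Printing Implicit Defensive.

Import GRing.Theory.

Local Open Scope ring_scope.

(* The letter (i, false) is the i-th generator, (i, true) is its inverse. *)
Definition word (n : nat) : Type := seq ('I_n * bool).

Definition letter_inv (n : nat) (l : 'I_n * bool) : 'I_n * bool :=
  (l.1, ~~ l.2).

(* The word x_i ^ k, for an exponent k of any sign. *)
Definition syllable (n : nat) (i : 'I_n) (k : int) : word n :=
  nseq `|k|%N (i, k < 0).

(* Equality in the group < x_0, ..., x_(n-1) | rels >: the elements of the
   group are the words up to the congruence presEq, the product is
   concatenation. *)
Inductive presEq (n : nat) (rels : seq (word n)) : word n -> word n -> Prop :=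
| presEq_refl u : presEq rels u u
| presEq_sym u v : presEq rels u v -> presEq rels v u
| presEq_trans u v w : presEq rels u v -> presEq rels v w -> presEq rels u w
| presEq_cat u u' v v' :
    presEq rels u u' -> presEq rels v v' -> presEq rels (u ++ v) (u' ++ v')
| presEq_cancel (l : 'I_n * bool) : presEq rels [:: l; letter_inv l] [::]
| presEq_rel r : r \in rels -> presEq rels r [::].

(* Group homomorphisms from < x_0, ..., x_(n-1) | rels > to SL_2(F); that
   rho [::] = 1 follows, since rho [::] is an invertible idempotent. *)
Definition is_SL2_rep (F : fieldType) (n : nat) (rels : seq (word n))
    (rho : word n -> 'M[F]_2) : Prop :=
  [/\ forall u v, presEq rels u v -> rho u = rho v,
      forall u v, rho (u ++ v) = rho u *m rho v
    & forall u, \det (rho u) = 1].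

(* The line spanned by v is invariant iff every rho u maps v to a multiple
   of v. *)
Definition irreducible_rep (F : fieldType) (n : nat)
    (rho : word n -> 'M[F]_2) : Prop :=
  ~ exists v : 'cV[F]_2,
      v != 0 /\ forall u : word n, exists c : F, rho u *m v = c *: v.

Definition gen_alpha : 'I_2 := ord0.
Definition gen_beta : 'I_2 := ord_max.

(* The coordinates of the character of rho, for a group generated by alpha and
   beta. *)
Definition char_point (F : fieldType) (rho : word 2 -> 'M[F]_2) : 3.-tuple F :=
  [tuple \tr (rho (syllable gen_alpha 1));
         \tr (rho (syllable gen_beta 1));
         \tr (rho (syllable gen_alpha 1 ++ syllable gen_beta 1))].

Definition char_variety (F : fieldType) (rels : seq (word 2)) :
    3.-tuple F -> Prop :=
  fun x => exists rho : word 2 -> 'M[F]_2,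
    is_SL2_rep rels rho /\ x = char_point rho.

Definition irr_character (F : fieldType) (rels : seq (word 2)) :
    3.-tuple F -> Prop :=
  fun x => exists rho : word 2 -> 'M[F]_2,
    [/\ is_SL2_rep rels rho, irreducible_rep rho & x = char_point rho].

Definition included (T : Type) (S S' : T -> Prop) : Prop :=
  forall x, S x -> S' x.

Definition vanishes_on (F : fieldType) (n : nat) (S : n.-tuple F -> Prop)
    (f : {mpoly F[n]}) : Prop :=
  forall x, S x -> f.@[tnth x] = 0.

Definition zariski_closed (F : fieldType) (n : nat)
    (S : n.-tuple F -> Prop) : Prop :=
  exists I : {mpoly F[n]} -> Prop,
    forall x, S x <-> (forall f, I f -> f.@[tnth x] = 0).

Definition zariski_closure (F : fieldType) (n : nat)
    (S : n.-tuple F -> Prop) : n.-tuple F -> Prop :=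
  fun x => forall Z, zariski_closed Z -> included S Z -> Z x.

(* Irreducibility for the subspace topology; S need not be closed. *)
Definition zariski_irreducible (F : fieldType) (n : nat)
    (S : n.-tuple F -> Prop) : Prop :=
  (exists x, S x) /\
  forall Z Z', zariski_closed Z -> zariski_closed Z' ->
    (forall x, S x -> Z x \/ Z' x) -> included S Z \/ included S Z'.

(* The irreducible components: the maximal irreducible subsets. *)
Definition is_component (F : fieldType) (n : nat)
    (X C : n.-tuple F -> Prop) : Prop :=
  [/\ zariski_irreducible C, included C X
    & forall D, zariski_irreducible D -> included D X ->
        included C D -> included D C].

(* A chain Z 0 < Z 1 < ... < Z d of irreducible closed sets contained in X. *)
Definition has_chain (F : fieldType) (n : nat) (X : n.-tuple F -> Prop)
    (d : nat) : Prop :=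
  exists Z : nat -> n.-tuple F -> Prop,
    (forall i, (i <= d)%N ->
       [/\ zariski_closed (Z i), zariski_irreducible (Z i)
         & included (Z i) X]) /\
    (forall i, (i < d)%N ->
       included (Z i) (Z i.+1) /\ ~ included (Z i.+1) (Z i)).

(* The Krull dimension of X is d. The empty set has no dimension in this sense,
   so that [has_dim X 0] entails that X is not empty. *)
Definition has_dim (F : fieldType) (n : nat) (X : n.-tuple F -> Prop)
    (d : nat) : Prop :=
  has_chain X d /\ ~ has_chain X d.+1.

Definition is_curve (F : fieldType) (n : nat)
    (C : n.-tuple F -> Prop) : Prop :=
  [/\ zariski_closed C, zariski_irreducible C & has_dim C 1].

(* The points of the smooth projective model of a curve C correspond to the
   normalized discrete valuations of the function field F(C) that are trivial
   on F. Such a valuation is determined by its restriction to the nonzero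
   elements of the coordinate ring F[C], given here as a function v on
   polynomials that depends only on their restriction to C; the value of v on
   the polynomials that vanish on C is irrelevant. *)
Definition is_place (F : fieldType) (n : nat) (C : n.-tuple F -> Prop)
    (v : {mpoly F[n]} -> int) : Prop :=
  [/\ forall f g, vanishes_on C (f - g) -> v f = v g,
      forall f g, ~ vanishes_on C f -> ~ vanishes_on C g ->
        v (f * g) = v f + v g,
      forall f g, ~ vanishes_on C f -> ~ vanishes_on C g ->
        ~ vanishes_on C (f + g) -> Num.min (v f) (v g) <= v (f + g),
      forall c : F, c != 0 -> v c%:MP = 0
    & exists f g, [/\ ~ vanishes_on C f, ~ vanishes_on C g & v f - v g = 1]].

(* The ideal points are the places at which some coordinate function has a
   pole, that is, those that are not centred at a point of the affine curve. *)
Definition is_ideal_point (F : fieldType) (n : nat) (C : n.-tuple F -> Prop)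
    (v : {mpoly F[n]} -> int) : Prop :=
  is_place C v /\ exists i : 'I_n, ~ vanishes_on C 'X_i /\ v 'X_i < 0.

Definition m188_rel1 : word 2 :=
  let a := syllable gen_alpha in let b := syllable gen_beta in
  a 3 ++ b (-1) ++ a 1 ++ b 2 ++ a 1 ++ b 2 ++ a 1 ++ b (-1).

Definition m188_rel2 : word 2 :=
  let a := syllable gen_alpha in let b := syllable gen_beta in
  a (-2) ++ b 3 ++ a (-2) ++ b 3 ++ a 1 ++ b (-1) ++ a 1 ++ b 3.

(* pi_1(m188(2,3)) = < alpha, beta | m188_rel1, m188_rel2 >. *)
Definition m188_rels : seq (word 2) := [:: m188_rel1; m188_rel2].

Definition X_M (F : fieldType) : 3.-tuple F -> Prop :=
  @char_variety F m188_rels.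

Definition irr_char_M (F : fieldType) : 3.-tuple F -> Prop :=
  @irr_character F m188_rels.

Definition Xirr_M (F : fieldType) : 3.-tuple F -> Prop :=
  zariski_closure (@irr_char_M F).

(* Main.v *)
Require Import Defs.
From HB Require Import structures.
From mathcomp Require Import all_boot all_order all_algebra.
From mathcomp Require Import mpoly.
From mathcomp Require Import ring.
From Stdlib Require Import Classical.

Set Implicit Arguments.
Unset Strict Implicit.
Unset Printing Implicit Defensive.

Import Order.TTheory GRing.Theory Num.Theory.

Local Open Scope ring_scope.

(** Write x, y, z for the traces of alpha, beta and alpha beta.  Each relator
    can be rewritten as an equality of two palindromes in alpha and beta:

      alpha beta^2 alpha beta^2 alpha = beta alpha^-3 beta,
      beta^3 alpha beta^-1 alpha beta^3 = alpha^2 beta^-3 alpha^2.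

    By Cayley-Hamilton the span of 1, A, B is stable under the maps
    U |-> A U A and U |-> B U B, whose matrices have entries in Z[x, y, z]
    ([mulA_pal_mulA], [mulB_pal_mulB]).  A relator therefore amounts to the
    vanishing of one combination of 1, A, B ([rel1_palP], [rel2_palP]).  In an
    irreducible representation 1, A, B are linearly independent ([pal_free]),
    and the irreducible characters satisfy six explicit polynomial equations
    ([irr_char_coef]); conversely, every solution for which the commutator does
    not have trace 2 is an irreducible character ([irr_char_intro]).

    If 2 is invertible, elimination leaves either y^2 = 2, z = 0, x^2 = 1, or
    u = y^2 a root of u^2 - u + 1, with x^2 and z^2 determined by u
    ([coef_solutions]); there are finitely many solutions, and
    (1, sqrt 2, 0) is one of them in every characteristic.  If 2 = 0, the
    solutions lie on the line of points (t, 0, 0) or in a finite set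
    ([coef_solutions_char2]); for t nonzero the point (t, 0, 0) is the character
    of an irreducible representation that maps beta and alpha beta to
    involutions ([axis_irr_char]).  A reducible character is a sum of two
    characters of degree one of the finite abelianization, so that these are
    finite in number in every characteristic ([reducible_finite]).

    It remains to know the irreducible closed subsets of the union of a line and
    a finite set: they are the line itself and the points
    ([zariski_irreducible_seq], [zariski_irreducible_in_axis]).  The ideal point
    of a curve of characters is the point at infinity of the line, whose
    valuation is minus the degree ([axis_ideal_point]). *)

(** * Two-by-two matrices and palindromes *)

Definition mx_of (F : fieldType) (a b c d : F) : 'M[F]_2 :=
  \matrix_(i, j) (if i == 0 then if j == 0 then a else b
                  else if j == 0 then c else d).

Lemma mx2_eta (F : fieldType) (A : 'M[F]_2) :
  A = mx_of (A 0 0) (A 0 1) (A 1 0) (A 1 1).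
Proof.
apply/matrixP=> i j; rewrite mxE.
by case: i => [[|[|//]] ?]; case: j => [[|[|//]] ?];
  congr (A _ _); apply/val_inj.
Qed.

Lemma det_mx_of (F : fieldType) (a b c d : F) :
  \det (mx_of a b c d) = a * d - b * c.
Proof.
rewrite (expand_det_row _ 0) !big_ord_recl big_ord0 /cofactor !det_mx11 !mxE /=.
by ring.
Qed.

Lemma trace_mx_of (F : fieldType) (a b c d : F) : \tr (mx_of a b c d) = a + d.
Proof. by rewrite /mxtrace !big_ord_recl big_ord0 !mxE /= addr0. Qed.

Lemma mul_mx_of (F : fieldType) (a b c d a' b' c' d' : F) :
  mx_of a b c d *m mx_of a' b' c' d' =
  mx_of (a * a' + b * c') (a * b' + b * d') (c * a' + d * c') (c * b' + d * d').
Proof.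
apply/matrixP=> i j; rewrite !mxE !big_ord_recl big_ord0 !mxE /= addr0.
by case: i => [[|[|//]] ?]; case: j => [[|[|//]] ?].
Qed.

Lemma add_mx_of (F : fieldType) (a b c d a' b' c' d' : F) :
  mx_of a b c d + mx_of a' b' c' d' = mx_of (a + a') (b + b') (c + c') (d + d').
Proof.
apply/matrixP=> i j; rewrite !mxE.
by case: i => [[|[|//]] ?]; case: j => [[|[|//]] ?].
Qed.

Lemma scale_mx_of (F : fieldType) (k a b c d : F) :
  k *: mx_of a b c d = mx_of (k * a) (k * b) (k * c) (k * d).
Proof.
apply/matrixP=> i j; rewrite !mxE.
by case: i => [[|[|//]] ?]; case: j => [[|[|//]] ?].
Qed.

Lemma scalar_mx_of (F : fieldType) (k : F) : k%:M = mx_of k 0 0 k.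
Proof.
apply/matrixP=> i j; rewrite !mxE.
by case: i => [[|[|//]] ?]; case: j => [[|[|//]] ?].
Qed.

(** The general element of the span of 1, A, B, which is where every word
    lies that reads the same backwards. *)
Definition pal (F : fieldType) (A B : 'M[F]_2) (c : F * F * F) : 'M[F]_2 :=
  c.1.1%:M + c.1.2 *: A + c.2 *: B.

(** The action of U |-> A U A on coordinates in 1, A, B, for matrices A, B of
    determinant 1 with x, y, z the traces of A, B, A B.  The entries come from
    A^2 = x A - 1 and A B A = z A + B - y. *)
Definition pal_conjA (F : fieldType) (x y z : F) (c : F * F * F) : F * F * F :=
  let: (p, q, r) := c in
  (- p - x * q - y * r, x * p + (x ^+ 2 - 1) * q + z * r, r).

Definition pal_conjB (F : fieldType) (x y z : F) (c : F * F * F) : F * F * F :=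
  let: (p, q, r) := c in
  (- p - x * q - y * r, q, y * p + z * q + (y ^+ 2 - 1) * r).

Definition mx2E := (mul_mx_of, scale_mx_of, scalar_mx_of, add_mx_of,
  trace_mx_of, det_mx_of).

Lemma mulA_pal_mulA (F : fieldType) (A B : 'M[F]_2) (c : F * F * F) :
  \det A = 1 ->
  A *m pal A B c *m A = pal A B (pal_conjA (\tr A) (\tr B) (\tr (A *m B)) c).
Proof.
case: c => [[p q] r]; rewrite /pal /pal_conjA /=.
rewrite (mx2_eta A) (mx2_eta B) !mx2E.
set a := A 0 0; set b := A 0 1; set c := A 1 0; set d := A 1 1 => h.
have {h} h : b * c = a * d - 1 by rewrite -h; ring.
by congr mx_of; ring : h.
Qed.

Lemma palC (F : fieldType) (A B : 'M[F]_2) (p q r : F) :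
  pal A B (p, q, r) = pal B A (p, r, q).
Proof. by rewrite /pal /= -!addrA [X in _ + X]addrC. Qed.

Lemma mulB_pal_mulB (F : fieldType) (A B : 'M[F]_2) (c : F * F * F) :
  \det B = 1 ->
  B *m pal A B c *m B = pal A B (pal_conjB (\tr A) (\tr B) (\tr (A *m B)) c).
Proof.
case: c => [[p q] r] hB; rewrite palC mulA_pal_mulA //= palC mxtrace_mulC.
by congr (pal _ _ (_, _, _)); ring.
Qed.

(** The adjugate, which is the inverse in determinant 1. *)
Definition inv2 (F : fieldType) (A : 'M[F]_2) : 'M[F]_2 := (\tr A)%:M - A.

Lemma inv2E (F : fieldType) (a b c d : F) :
  inv2 (mx_of a b c d) = mx_of d (- b) (- c) a.
Proof.
by rewrite /inv2 -scaleN1r !mx2E; congr mx_of; ring.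
Qed.

Lemma mul_inv2 (F : fieldType) (A : 'M[F]_2) : \det A = 1 -> A *m inv2 A = 1%:M.
Proof.
rewrite (mx2_eta A) inv2E !mx2E => h.
by congr mx_of; rewrite -?h; ring.
Qed.

Lemma inv2_mul (F : fieldType) (A : 'M[F]_2) : \det A = 1 -> inv2 A *m A = 1%:M.
Proof. by move=> h; apply/mulmx1C/mul_inv2. Qed.

Lemma det_inv2 (F : fieldType) (A : 'M[F]_2) : \det (inv2 A) = \det A.
Proof. by rewrite (mx2_eta A) inv2E !mx2E; ring. Qed.

Lemma inv2_pal (F : fieldType) (A B : 'M[F]_2) :
  inv2 A = pal A B (\tr A, -1, 0).
Proof. by rewrite /inv2 /pal /= scale0r addr0 scaleN1r. Qed.

Lemma inv2_cube_pal (F : fieldType) (A B : 'M[F]_2) : \det A = 1 ->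
  inv2 A *m inv2 A *m inv2 A =
  pal A B (\tr A ^+ 3 - \tr A *+ 2, 1 - \tr A ^+ 2, 0).
Proof.
rewrite /pal /= scale0r addr0.
rewrite (mx2_eta A) inv2E !mx2E.
set a := A 0 0; set b := A 0 1; set c := A 1 0; set d := A 1 1 => h.
have {h} h : b * c = a * d - 1 by rewrite -h; ring.
by congr mx_of; ring : h.
Qed.

(** * Representations given by the images of the generators *)

Definition letter_mx (F : fieldType) (n : nat) (g : 'I_n -> 'M[F]_2)
    (l : 'I_n * bool) : 'M[F]_2 :=
  if l.2 then inv2 (g l.1) else g l.1.

Definition word_mx (F : fieldType) (n : nat) (g : 'I_n -> 'M[F]_2)
    (u : word n) : 'M[F]_2 :=
  foldr (fun l M => letter_mx g l *m M) 1%:M u.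

Lemma word_mx_cat (F : fieldType) (n : nat) (g : 'I_n -> 'M[F]_2)
    (u v : word n) : word_mx g (u ++ v) = word_mx g u *m word_mx g v.
Proof. by elim: u => [|l u IH] /=; rewrite ?mul1mx // IH mulmxA. Qed.

Lemma word_mx_rep (F : fieldType) (n : nat) (rels : seq (word n))
    (g : 'I_n -> 'M[F]_2) :
  (forall i, \det (g i) = 1) -> (forall r, r \in rels -> word_mx g r = 1%:M) ->
  is_SL2_rep rels (word_mx g).
Proof.
move=> g1 relg; split; last 2 first.
- exact: word_mx_cat.
- elim=> [|[i b] u IH] /=; first by rewrite det1.
  by rewrite det_mulmx IH mulr1 /letter_mx; case: b; rewrite /= ?det_inv2.
move=> u v; elim=> {u v} //.
- by move=> u v w _ -> _ ->.
- by move=> u u' v v' _ eu _ ev; rewrite !word_mx_cat eu ev.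
case=> i b; rewrite /= mulmx1 /letter_mx /=.
by case: b; rewrite /= ?inv2_mul ?mul_inv2.
Qed.

(** The image of the empty word is an invertible idempotent, hence 1, so that
    the image of an inverse letter is an inverse matrix, and the images of the
    generators determine the representation. *)
Lemma SL2_rep_word_mx (F : fieldType) (n : nat) (rels : seq (word n))
    (rho : word n -> 'M[F]_2) : is_SL2_rep rels rho ->
  exists g : 'I_n -> 'M[F]_2,
    [/\ forall i, \det (g i) = 1, forall r, r \in rels -> word_mx g r = 1%:M
      & rho =1 word_mx g].
Proof.
move=> [cong morph det1rho]; pose g i := rho [:: (i, false)]; exists g.
have rho0 : rho [::] = 1%:M.
  have := morph [::] [::]; rewrite cats0 => h.
  have := congr1 (fun M => inv2 (rho [::]) *m M) h.
  by rewrite mulmxA !inv2_mul // mul1mx.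
have rhoE : rho =1 word_mx g.
  elim=> [|[i b] u IH] //=; rewrite -cat1s morph IH; congr (_ *m _).
  rewrite /letter_mx; case: b => //=.
  have /cong := presEq_cancel rels (i, false).
  rewrite -cat1s morph rho0 => /(congr1 (mulmx (inv2 (g i)))).
  by rewrite mulmxA inv2_mul /g // mul1mx mulmx1.
split=> // [i|r rr]; first exact: det1rho.
by rewrite -rhoE -rho0; apply: cong; apply: presEq_rel.
Qed.

Definition shared_eigenvector (F : fieldType) (n : nat) (g : 'I_n -> 'M[F]_2)
    (v : 'cV[F]_2) : Prop :=
  v != 0 /\ forall i, exists c : F, g i *m v = c *: v.

Lemma eigenvector_inv2 (F : fieldType) (A : 'M[F]_2) (v : 'cV[F]_2) (c : F) :
  \det A = 1 -> v != 0 -> A *m v = c *: v ->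
  c != 0 /\ inv2 A *m v = c^-1 *: v.
Proof.
move=> A1 v0 Av.
have h : v = c *: (inv2 A *m v).
  by rewrite scalemxAr -Av mulmxA inv2_mul // mul1mx.
have c0 : c != 0.
  by apply: contra_neq v0 => c0; rewrite h c0 scale0r.
by split=> //; rewrite {2}h scalerA mulVf // scale1r.
Qed.

Lemma irreducible_rep_word_mx (F : fieldType) (n : nat) (g : 'I_n -> 'M[F]_2) :
  (forall i, \det (g i) = 1) ->
  irreducible_rep (word_mx g) <-> forall v, ~ shared_eigenvector g v.
Proof.
move=> g1; split=> [irr v [v0 gv]|irr [v [v0 rv]]].
  apply: irr; exists v; split=> //; elim=> [|[i b] u [c IH]] /=.
    by exists 1; rewrite mul1mx scale1r.
  have [d gd] := gv i; rewrite -mulmxA IH -scalemxAr /letter_mx.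
  case: b => /=; last by exists (c * d); rewrite gd scalerA.
  by have [_ ->] := eigenvector_inv2 (g1 i) v0 gd; exists (c / d); rewrite scalerA.
apply: (irr v); split=> // i; have [c] := rv [:: (i, false)].
by rewrite /= mulmx1; exists c.
Qed.

(** By Cayley-Hamilton the inverse of A is tr A - A; apply it to v. *)
Lemma trace_eigen (F : fieldType) (A : 'M[F]_2) (v : 'cV[F]_2) (c : F) :
  \det A = 1 -> v != 0 -> A *m v = c *: v -> \tr A = c + c^-1.
Proof.
move=> A1 v0 Av; have [_ ] := eigenvector_inv2 A1 v0 Av.
rewrite {1}/inv2 mulmxBl Av mul_scalar_mx => /eqP.
rewrite -scalerBl -subr_eq0 -scalerBl scaler_eq0 (negPf v0) orbF.
by rewrite subr_eq0 subr_eq addrC => /eqP.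
Qed.

Lemma exists_eigenvector (F : closedFieldType) (A : 'M[F]_2) :
  exists v : 'cV[F]_2, v != 0 /\ exists c, A *m v = c *: v.
Proof.
have [|c] := closed_rootP (char_poly A^T) _; first by rewrite size_char_poly.
rewrite -eigenvalue_root_char => /eigenvalueP[v Av v0].
exists v^T; split; first by rewrite -[0]trmx0 (inj_eq trmx_inj).
by exists c; rewrite -{1}(trmxK A) -trmx_mul Av linearZ.
Qed.

(** If 1, A, B are linearly dependent, then B is affine in A or A is scalar, so
    that an eigenvector of one of them is one of the other. *)
Lemma pal_free (F : closedFieldType) (A B : 'M[F]_2) (c : F * F * F) :
  (forall v : 'cV[F]_2, v != 0 ->
     ~ ((exists a, A *m v = a *: v) /\ exists b, B *m v = b *: v)) ->
  pal A B c = 0 -> c = (0, 0, 0).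
Proof.
case: c => [[p q] r] irr; rewrite /pal /= => h.
have hv (v : 'cV[F]_2) : p *: v + q *: (A *m v) + r *: (B *m v) = 0.
  by rewrite -mul_scalar_mx !scalemxAl -!mulmxDl h mul0mx.
have solve (k : F) (w : 'cV[F]_2) (u : 'cV[F]_2) :
    k != 0 -> k *: w = u -> w = k^-1 *: u.
  by move=> k0 <-; rewrite scalerA mulVf // scale1r.
have [r0|r0] := eqVneq r 0; last first.
  have [v [v0 [a Av]]] := exists_eigenvector A.
  case: (irr v v0); split; first by exists a.
  exists (r^-1 * - (p + q * a)); rewrite -scalerA; apply: solve => //.
  have := hv v; rewrite Av scalerA -scalerDl addrC => /eqP.
  by rewrite addr_eq0 -scaleNr => /eqP.
have [q0|q0] := eqVneq q 0; last first.
  have [v [v0 [b Bv]]] := exists_eigenvector B.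
  case: (irr v v0); split; last by exists b.
  exists (q^-1 * - p); rewrite -scalerA; apply: solve => //.
  have := hv v; rewrite r0 scale0r addr0 addrC => /eqP.
  by rewrite addr_eq0 -scaleNr => /eqP.
move: h; rewrite r0 q0 !scale0r !addr0 => /matrixP/(_ 0 0).
by rewrite !mxE /= mulr1n => ->.
Qed.

(** * The relators as polynomial conditions on traces *)

(** The coordinates in 1, A, B of the difference between the two palindromes
    equated by the first relator. *)
Definition rel1_coef (F : fieldType) (x y z : F) : F * F * F :=
  (- y ^+ 3 * z + x * y ^+ 2 + y * z - x *+ 2,
   y ^+ 2 * z ^+ 2 - (x * y * z) *+ 2 + (x ^+ 2) *+ 2 - 2,
   - x ^+ 3 * y + x ^+ 2 * z + y ^+ 2 * z + x * y - z).

(** The same coordinates for the second relator. *)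
Definition rel2_coef (F : fieldType) (x y z : F) : F * F * F :=
  (- x * y ^+ 4 * z + (x ^+ 2 * y ^+ 3) *+ 2 + y ^+ 5 + y ^+ 3 * z ^+ 2
   - x * y ^+ 2 * z - (x ^+ 2 * y) *+ 3 - (y ^+ 3) *+ 5 - y * z ^+ 2
   + (x * z) *+ 2 + y *+ 5,
   - x ^+ 3 * y ^+ 3 + x ^+ 2 * y ^+ 2 * z + (x ^+ 3 * y) *+ 2 + x * y ^+ 3
   - x ^+ 2 * z - (x * y) *+ 2 - z,
   x * y ^+ 5 * z - x ^+ 2 * y ^+ 4 - y ^+ 6 - y ^+ 4 * z ^+ 2
   - x * y ^+ 3 * z + x ^+ 2 * y ^+ 2 + (y ^+ 4) *+ 5 + (y ^+ 2 * z ^+ 2) *+ 2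
   - (y ^+ 2) *+ 5 - z ^+ 2).

Lemma pal_eqP (F : fieldType) (A B : 'M[F]_2) (p q r p' q' r' p'' q'' r'' : F) :
  p - p' = p'' -> q - q' = q'' -> r - r' = r'' ->
  pal A B (p, q, r) = pal A B (p', q', r') <-> pal A B (p'', q'', r'') = 0.
Proof.
move=> <- <- <-.
have -> : pal A B (p - p', q - q', r - r') =
          pal A B (p, q, r) - pal A B (p', q', r').
  by apply/matrixP=> i j; rewrite !mxE /=; case: (i == j); ring.
by split=> [->|/eqP]; rewrite ?subrr // subr_eq0 => /eqP.
Qed.

Lemma rel1_palindrome (R : pzRingType) (a a' b b' : R) :
  a * a' = 1 -> a' * a = 1 -> b * b' = 1 -> b' * b = 1 ->
  a * (a * (a * (b' * (a * (b * (b * (a * (b * (b * (a * b')))))))))) = 1 <->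
  a * (b * (b * a * b) * b) * a = b * (a' * a' * a') * b.
Proof.
move=> aa' a'a bb' b'b.
have Ka X : a' * (a * X) = X by rewrite mulrA a'a mul1r.
have Ka' X : a * (a' * X) = X by rewrite mulrA aa' mul1r.
have Kb X : b' * (b * X) = X by rewrite mulrA b'b mul1r.
have Kb' X : b * (b' * X) = X by rewrite mulrA bb' mul1r.
rewrite -!mulrA; split=> [|h].
  move/(congr1 (fun M => b * (a' * (a' * (a' * (M * b)))))).
  by rewrite mul1r -!mulrA !(Ka, Kb') b'b mulr1.
have -> : a * (b * (b * (a * (b * (b * (a * b')))))) =
          b * (a' * (a' * a')).
  by move/(congr1 (fun M => M * b')): h; rewrite -!mulrA bb' mulr1.
by rewrite Kb !Ka'.
Qed.

Lemma rel2_palindrome (R : pzRingType) (a a' b b' : R) :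
  a * a' = 1 -> a' * a = 1 -> b * b' = 1 -> b' * b = 1 ->
  a' * (a' * (b * (b * (b * (a' * (a' * (b * (b * (b * (a * (b' *
    (a * (b * (b * b)))))))))))))) = 1 <->
  b * (b * (b * (a * b' * a) * b) * b) * b =
  a * (a * (b' * b' * b') * a) * a.
Proof.
move=> aa' a'a bb' b'b.
have Ka X : a' * (a * X) = X by rewrite mulrA a'a mul1r.
have Ka' X : a * (a' * X) = X by rewrite mulrA aa' mul1r.
have Kb X : b' * (b * X) = X by rewrite mulrA b'b mul1r.
have Kb' X : b * (b' * X) = X by rewrite mulrA bb' mul1r.
rewrite -!mulrA; split=> [|->]; last by rewrite !(Kb', Ka) a'a.
move/(congr1 (fun M => a * (a * (b' * (b' * (b' * (a * (a * M)))))))).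
by rewrite !(Ka', Kb) mulr1.
Qed.

(** Both sides of alpha beta^2 alpha beta^2 alpha = beta alpha^-3 beta are
    obtained from a power of alpha by maps U |-> A U A and U |-> B U B. *)
Lemma rel1_palP (F : fieldType) (g : 'I_2 -> 'M[F]_2) :
  let A := g gen_alpha in let B := g gen_beta in
  \det A = 1 -> \det B = 1 ->
  word_mx g m188_rel1 = 1%:M <->
  pal A B (rel1_coef (\tr A) (\tr B) (\tr (A *m B))) = 0.
Proof.
move=> A B A1 B1.
rewrite /m188_rel1 /word_mx /syllable /= /letter_mx /= -/A -/B mulmx1.
clearbody A B.
have rearr := rel1_palindrome (mul_inv2 A1) (inv2_mul A1)
  (mul_inv2 B1) (inv2_mul B1).
rewrite -!mulmxE in rearr; apply: (iff_trans rearr) => {rearr}.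
rewrite (_ : A *m (B *m (B *m A *m B) *m B) *m A =
  A *m (B *m (B *m pal A B (0, 1, 0) *m B) *m B) *m A); last first.
  by rewrite /pal /= raddf0 add0r scale1r scale0r addr0.
rewrite (inv2_cube_pal B A1) !mulB_pal_mulB // mulA_pal_mulA //.
by apply: pal_eqP; ring.
Qed.

(** Likewise for beta^3 alpha beta^-1 alpha beta^3 = alpha^2 beta^-3 alpha^2,
    starting from powers of beta. *)
Lemma rel2_palP (F : fieldType) (g : 'I_2 -> 'M[F]_2) :
  let A := g gen_alpha in let B := g gen_beta in
  \det A = 1 -> \det B = 1 ->
  word_mx g m188_rel2 = 1%:M <->
  pal A B (rel2_coef (\tr A) (\tr B) (\tr (A *m B))) = 0.
Proof.
move=> A B A1 B1.
rewrite /m188_rel2 /word_mx /syllable /= /letter_mx /= -/A -/B mulmx1.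
clearbody A B.
have rearr := rel2_palindrome (mul_inv2 A1) (inv2_mul A1)
  (mul_inv2 B1) (inv2_mul B1).
rewrite -!mulmxE in rearr; apply: (iff_trans rearr) => {rearr}.
have cube : inv2 B *m inv2 B *m inv2 B =
    pal A B (\tr B ^+ 3 - \tr B *+ 2, 0, 1 - \tr B ^+ 2).
  by rewrite palC; apply: inv2_cube_pal.
have inv : inv2 B = pal A B (\tr B, 0, -1) by rewrite palC; apply: inv2_pal.
rewrite cube inv !mulA_pal_mulA // !mulB_pal_mulB //.
by apply: pal_eqP; ring.
Qed.

(** The value at u of the homomorphism to the nonzero scalars that extends e: the
    eigenvalue of u on a common eigenvector. *)
Definition word_scalar (F : fieldType) (n : nat) (e : 'I_n -> F) (u : word n) : F :=
  foldr (fun l s => (if l.2 then (e l.1)^-1 else e l.1) * s) 1 u.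

Lemma word_mx_eigenvector (F : fieldType) (n : nat) (g : 'I_n -> 'M[F]_2)
    (v : 'cV[F]_2) (e : 'I_n -> F) :
  (forall i, \det (g i) = 1) -> v != 0 -> (forall i, g i *m v = e i *: v) ->
  forall u, word_mx g u *m v = word_scalar e u *: v.
Proof.
move=> g1 v0 gv; elim=> [|[i b] u IH] /=; first by rewrite mul1mx scale1r.
rewrite -mulmxA IH -scalemxAr /letter_mx mulrC -scalerA; congr (_ *: _).
by case: b; rewrite //=; have [_ ->] := eigenvector_inv2 (g1 i) v0 (gv i).
Qed.

Lemma shared_eigenvector_traces (F : fieldType) (g : 'I_2 -> 'M[F]_2)
    (v : 'cV[F]_2) : (forall i, \det (g i) = 1) -> shared_eigenvector g v ->
  exists e : 'I_2 -> F,
    let a := e gen_alpha in let b := e gen_beta in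
    [/\ a != 0, b != 0, forall u, word_mx g u = 1%:M -> word_scalar e u = 1,
        \tr (g gen_alpha) = a + a^-1 & \tr (g gen_beta) = b + b^-1 /\
        \tr (g gen_alpha *m g gen_beta) = a * b + (a * b)^-1].
Proof.
move=> g1 [v0 /fin_all_exists[e gv]]; exists e => a b; split.
- by have [] := eigenvector_inv2 (g1 _) v0 (gv gen_alpha).
- by have [] := eigenvector_inv2 (g1 _) v0 (gv gen_beta).
- move=> u u1; have := word_mx_eigenvector g1 v0 gv u.
  rewrite u1 mul1mx -{1}[v]scale1r => /eqP; rewrite -subr_eq0 -scalerBl.
  by rewrite scaler_eq0 (negPf v0) orbF subr_eq0 => /eqP.
- exact: trace_eigen (g1 _) v0 (gv _).
split; first exact: trace_eigen (g1 _) v0 (gv _).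
apply: (@trace_eigen _ _ v) => //; first by rewrite det_mulmx !g1 mulr1.
by rewrite -mulmxA gv -scalemxAr gv scalerA mulrC.
Qed.

Lemma generatorP (i : 'I_2) : i = gen_alpha \/ i = gen_beta.
Proof. by case: i => [[|[|//]] ?]; [left | right]; apply/val_inj. Qed.

Lemma m188_word_relP (F : fieldType) (g : 'I_2 -> 'M[F]_2) :
  (forall r, r \in m188_rels -> word_mx g r = 1%:M) <->
  word_mx g m188_rel1 = 1%:M /\ word_mx g m188_rel2 = 1%:M.
Proof.
split=> [h|[h1 h2] r]; first by split; apply: h; rewrite !inE eqxx ?orbT.
by rewrite !inE => /orP[] /eqP ->.
Qed.

Lemma char_point_word_mx (F : fieldType) (g : 'I_2 -> 'M[F]_2) :
  char_point (word_mx g) =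
  [tuple \tr (g gen_alpha); \tr (g gen_beta); \tr (g gen_alpha *m g gen_beta)].
Proof.
by apply/val_inj; rewrite /char_point word_mx_cat /syllable /= /letter_mx /= !mulmx1.
Qed.

Lemma char_point_eq (F : fieldType) (rho rho' : word 2 -> 'M[F]_2) :
  rho =1 rho' -> char_point rho = char_point rho'.
Proof. by move=> e; apply/val_inj; rewrite /= !e. Qed.

(** Without a common eigenvector 1, A, B are linearly independent, so that each
    relator forces its three coordinates to vanish. *)
Lemma irr_char_coef (F : closedFieldType) (p : 3.-tuple F) : irr_char_M p ->
  exists x y z, [/\ p = [tuple x; y; z], rel1_coef x y z = (0, 0, 0)
                  & rel2_coef x y z = (0, 0, 0)].
Proof.
move=> [rho [rep irr ->]].
have [g [g1 /m188_word_relP[r1 r2] rhoE]] := SL2_rep_word_mx rep.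
rewrite (char_point_eq rhoE) char_point_word_mx.
set A := g gen_alpha; set B := g gen_beta.
exists (\tr A), (\tr B), (\tr (A *m B)).
have free c : pal A B c = 0 -> c = (0, 0, 0).
  apply: pal_free => v v0 [[a Av] [b Bv]]; case: irr; exists v; split=> // u.
  rewrite rhoE; pose e (i : 'I_2) := if i == gen_alpha then a else b.
  exists (word_scalar e u); apply: word_mx_eigenvector => // i.
  by have [->|->] := generatorP i; rewrite /e ?eqxx; [exact: Av | exact: Bv].
by split=> //; apply: free; [apply/rel1_palP | apply/rel2_palP].
Qed.

(** On a common eigenvector the group acts through its abelianization, which has
    exponent 26: the relators give a^6 b^2 = 1 and b^8 = a^2. *)
Lemma char_variety_cases (F : closedFieldType) (p : 3.-tuple F) : X_M p ->
  irr_char_M p \/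
  exists a b, [/\ a ^+ 26 = 1, b ^+ 26 = 1
    & p = [tuple a + a^-1; b + b^-1; a * b + (a * b)^-1]].
Proof.
move=> [rho [rep pE]].
have [irr|/NNPP red] := classic (irreducible_rep rho); [left|right].
  by exists rho.
have [g [g1 rels1 rhoE]] := SL2_rep_word_mx rep.
have [v gv] : exists v, shared_eigenvector g v.
  case: red => v [v0 rv]; exists v; split=> // i.
  by have [c] := rv [:: (i, false)]; rewrite rhoE /= mulmx1; exists c.
have [e /= [a0 b0 e1 ta [tb tab]]] := shared_eigenvector_traces g1 gv.
rewrite pE (char_point_eq rhoE) char_point_word_mx ta tb tab.
have /m188_word_relP[/e1 + /e1] := rels1.
rewrite /m188_rel1 /m188_rel2 /word_scalar /=.
move: (e gen_alpha) (e gen_beta) a0 b0 => a b a0 b0 r1 r2.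
have ab : a ^+ 6 * b ^+ 2 = 1 by rewrite -r1; field.
have ba : b ^+ 8 = a ^+ 2.
  by rewrite -[RHS]mulr1 -r2; field; rewrite b0 a0.
have b26 : b ^+ 26 = 1.
  by rewrite -[RHS]ab (exprM a 2 3) -ba -exprM -exprD.
exists a, b; split=> //.
by rewrite (exprM a 2 13) -ba -exprM (exprM b 26 4) b26 expr1n.
Qed.

(** Any three scalars are the traces of some A, B, A B: take for B a matrix with
    zero in a corner and off-diagonal entries q and -1/q, where q + 1/q = z. *)
Lemma exists_SL2_traces (F : closedFieldType) (x y z : F) :
  exists A B : 'M[F]_2, [/\ \det A = 1, \det B = 1,
    \tr A = x, \tr B = y & \tr (A *m B) = z].
Proof.
have [//|q] := solve_monicpoly (fun i => [:: -1; z]`_i) (n := 2).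
rewrite !big_ord_recl big_ord0 /= expr0 expr1 mulr1 addr0 => hq.
have q0 : q != 0.
  apply/eqP=> q0; move/eqP: hq; rewrite q0 mulr0 addr0 expr2 mulr0 eq_sym.
  by rewrite oppr_eq0 oner_eq0.
exists (mx_of x (-1) 1 0), (mx_of 0 q (- q^-1) y); rewrite !mx2E.
split; try by field.
by apply: (mulfI q0); field : hq.
Qed.

(** The polynomial required to be nonzero is the trace of the commutator minus
    2, which vanishes as soon as A and B have a common eigenvector. *)
Lemma irr_char_intro (F : closedFieldType) (x y z : F) :
  rel1_coef x y z = (0, 0, 0) -> rel2_coef x y z = (0, 0, 0) ->
  x ^+ 2 + y ^+ 2 + z ^+ 2 - x * y * z - 4 != 0 ->
  irr_char_M [tuple x; y; z].
Proof.
move=> r1 r2 k0; have [A [B [A1 B1 tA tB tAB]]] := exists_SL2_traces x y z.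
pose g (i : 'I_2) := if i == gen_alpha then A else B.
have g1 i : \det (g i) = 1 by rewrite /g; case: ifP.
exists (word_mx g); split; last by rewrite char_point_word_mx /g /= tA tB tAB.
- apply: word_mx_rep => //; apply/m188_word_relP.
  have pal0 : pal A B (0, 0, 0) = 0 by rewrite /pal /= raddf0 !scale0r !addr0.
  split; [apply/rel1_palP | apply/rel2_palP] => //.
    by rewrite {2 4}/g /= tA tB tAB r1.
  by rewrite /g /= tA tB tAB r2.
apply/irreducible_rep_word_mx => // v /(shared_eigenvector_traces g1).
rewrite /g /= tA tB tAB => -[e [a0 b0 _ xE [yE zE]]].
by case/eqP: k0; rewrite xE yE zE; field; rewrite a0 b0.
Qed.

(** * Solutions of the polynomial conditions *)

(** In terms of u = y^2 and w = y z, the first equation gives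
    x (u - 2) = w (u - 1).  Using it to eliminate x from the second equations of
    both relators expresses w^2 as a function of u in two ways, and comparing
    them gives (u - 2)^4 (u^2 - u + 1) = 0. *)
Lemma coef_solutions (F : fieldType) (x y z : F) : (2 : F) != 0 ->
  rel1_coef x y z = (0, 0, 0) -> rel2_coef x y z = (0, 0, 0) ->
  [/\ y ^+ 2 = 2, z = 0 & x ^+ 2 = 1] \/
  [/\ y ^+ 12 = 1, x ^+ 2 = 2 * (1 - y ^+ 2) & z ^+ 2 = 6 * y ^+ 10].
Proof.
move=> two0 [e1 e2 _] [_ e5 _].
pose u := y ^+ 2; pose w := y * z.
have y0 : y != 0.
  apply/eqP=> y0; move: e1 e2; rewrite y0 => e1 e2.
  have x0 : x = 0 by apply: (mulfI two0); rewrite mulr0 -[RHS]oppr0 -e1; ring.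
  by case/eqP: two0; apply: oppr_inj; rewrite oppr0 -e2 x0; ring.
have xw : x * (u - 2) = w * (u - 1).
  by apply: subr0_eq; rewrite -e1 /u /w; ring.
(* For u = 2 the equation in x forces w = 0. *)
have [u2|] := eqVneq u 2.
  have z0 : z = 0.
    move/eqP: xw; rewrite u2 subrr mulr0 [2 - 1]addrK mulr1 eq_sym.
    by rewrite /w mulf_eq0 (negPf y0) => /eqP.
  left; split=> //; apply: (mulfI two0); apply: subr0_eq.
  by rewrite -e2 z0; ring.
rewrite -subr_eq0 => u2; right.
have w2 : w ^+ 2 * (u ^+ 2 - 2 * u + 2) = 2 * (u - 2) ^+ 2.
  apply: subr0_eq; transitivity
    ((w * (u - 2) - w * (u - 1)) ^+ 2 + (w * (u - 1)) ^+ 2 - 2 * (u - 2) ^+ 2).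
    by ring.
  by rewrite -xw -[RHS](mulr0 ((u - 2) ^+ 2)) -e2 /u /w; ring.
have w0 : w != 0.
  apply/eqP=> w0; move/eqP: w2; rewrite w0 expr0n mul0r eq_sym mulf_eq0.
  by rewrite (negPf two0) expf_eq0 (negPf u2).
(* The elimination of x multiplies the equation by y (u - 2)^3. *)
have w4 : w ^+ 2 * (u - 1) ^+ 4 = (u - 2) ^+ 2 * (u ^+ 2 - u - 1).
  apply: (mulfI (mulf_neq0 u2 w0)); apply: subr0_eq; transitivity
    (- ((w * (u - 1)) ^+ 3 * (2 * u - u ^+ 2)
        + (w * (u - 1)) ^+ 2 * w * (u - 1) * (u - 2)
        + (u - 2) ^+ 2 * (w * (u - 1)) * (u ^+ 2 - 2 * u) - w * (u - 2) ^+ 3)).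
    by ring.
  by rewrite -xw -[RHS](mulr0 (- (u - 2) ^+ 3 * y)) -e5 /u /w; ring.
have u6 : u ^+ 2 - u + 1 = 0.
  apply: (mulfI (expf_neq0 4 u2)); rewrite mulr0.
  transitivity ((u - 2) ^+ 2 *
    (2 * (u - 1) ^+ 4 - (u ^+ 2 - u - 1) * (u ^+ 2 - 2 * u + 2))).
    by ring.
  rewrite mulrBr [X in _ - X]mulrA -w4 mulrCA mulrA -w2; ring.
have uE : u ^+ 2 = u - 1 by apply: subr0_eq; rewrite -u6; ring.
have u3 : u ^+ 3 = -1 by rewrite exprS uE mulrBr -expr2 uE; ring.
have u1 : u - 1 != 0 by rewrite -uE expf_neq0 // /u expf_neq0.
have w2' : w ^+ 2 * (1 - u) = 2 * (u - 2) ^+ 2 by rewrite -w2 uE; ring.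
have w2E : w ^+ 2 = 6.
  apply: (mulIf u1); transitivity (- (w ^+ 2 * (1 - u))); first by ring.
  rewrite w2'; transitivity (-2 * (u ^+ 2 - 4 * u + 4)); first by ring.
  by rewrite uE; ring.
have y12 : y ^+ 12 = 1 by rewrite (exprM y 2 6) -/u (exprM u 3 2) u3; ring.
split=> //.
- apply: (mulIf (expf_neq0 2 u2)); rewrite -exprMn xw -/u [RHS]mulrAC -w2'.
  by ring.
by rewrite -w2E -[LHS]mulr1 -y12 /w; ring.
Qed.

(** Modulo 2 the second equation becomes (y z)^2 = 0; then y = 0 forces z = 0,
    and z = 0 with y nonzero forces x = 0 and y^4 + y^2 + 1 = 0. *)
Lemma coef_solutions_char2 (F : fieldType) (x y z : F) : (2 : F) = 0 ->
  rel1_coef x y z = (0, 0, 0) -> rel2_coef x y z = (0, 0, 0) ->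
  z = 0 /\ (y = 0 \/ x = 0 /\ y ^+ 6 = 1).
Proof.
move=> two0 [e1 e2 _] [e4 _ e6].
have /eqP : (y * z) ^+ 2 = 0.
  rewrite -[RHS]e2; transitivity (y ^+ 2 * z ^+ 2 + 2 * (x ^+ 2 - x * y * z - 1)).
    by rewrite two0; ring.
  by ring.
rewrite expf_eq0 mulf_eq0 /= => /orP[/eqP y0|/eqP z0].
  split; last by left.
  apply/eqP; rewrite -sqrf_eq0; apply/eqP/oppr_inj; rewrite oppr0 -e6 y0; ring.
split=> //; have [->|y0] := eqVneq y 0; [by left | right].
have x0 : x = 0.
  apply: (mulIf (expf_neq0 2 y0)); rewrite mul0r -e1 z0.
  transitivity (x * y ^+ 2 - 2 * x); first by rewrite two0; ring.
  by ring.
split=> //; apply: subr0_eq.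
have y4 : y ^+ 4 + y ^+ 2 + 1 = 0.
  apply: (mulfI y0); rewrite mulr0 -e4 z0 x0.
  transitivity (y * (y ^+ 4 + y ^+ 2 + 1) - 2 * (y ^+ 3 *+ 3 - y *+ 2)).
    by rewrite two0; ring.
  by ring.
by rewrite -(mulr0 (y ^+ 2 - 1)) -y4; ring.
Qed.

(** * Irreducible closed sets and finite sets *)

Lemma zariski_closed1 (F : fieldType) (n : nat) (a : n.-tuple F) :
  zariski_closed (fun x => x = a).
Proof.
exists (fun f => exists i, f = 'X_i - (tnth a i)%:MP) => x; split=> [->|h].
  by move=> f [i ->]; rewrite mevalB mevalXU mevalC subrr.
apply: eq_from_tnth => i; apply/eqP; rewrite -subr_eq0; apply/eqP.
by have := h _ (ex_intro _ i erefl); rewrite mevalB mevalXU mevalC.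
Qed.

Lemma zariski_closedU (F : fieldType) (n : nat) (Z Z' : n.-tuple F -> Prop) :
  zariski_closed Z -> zariski_closed Z' ->
  zariski_closed (fun x => Z x \/ Z' x).
Proof.
move=> [I IP] [I' IP'].
exists (fun h => exists f f', [/\ I f, I' f' & h = f * f']) => x; split.
  case=> [/IP Zx|/IP' Z'x] _ [f [f' [If If' ->]]]; rewrite mevalM.
    by rewrite (Zx _ If) mul0r.
  by rewrite (Z'x _ If') mulr0.
move=> h; apply: NNPP => /not_or_and[]; rewrite IP IP' => nZ nZ'.
apply: nZ => f If; apply: NNPP => fx; apply: nZ' => f' If'.
have /eqP := h _ (ex_intro _ f (ex_intro _ f' (And3 If If' erefl))).
by rewrite mevalM mulf_eq0 => /orP[] /eqP.
Qed.

Lemma zariski_closed_seq (F : fieldType) (n : nat) (s : seq (n.-tuple F)) :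
  zariski_closed (fun x => x \in s).
Proof.
elim: s => [|a s IH].
  by exists (fun f => f = 1) => x; split=> // /(_ _ erefl) /eqP;
    rewrite meval1 oner_eq0.
have [I IP] := zariski_closedU (zariski_closed1 a) IH.
by exists I => x; rewrite -IP inE; split=> [/orP[/eqP|]|[->|->]]; auto;
  rewrite ?eqxx ?orbT.
Qed.

Lemma zariski_irreducible1 (F : fieldType) (n : nat) (a : n.-tuple F) :
  zariski_irreducible (fun x => x = a).
Proof.
by split=> [|Z Z' _ _ h]; [exists a | case: (h a erefl) => ?; [left|right] => x ->].
Qed.

(** Points are closed, so the points of s can be split off one at a time. *)
Lemma zariski_irreducible_seq (F : fieldType) (n : nat)
    (S : n.-tuple F -> Prop) (Z : n.-tuple F -> Prop) (s : seq (n.-tuple F)) :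
  zariski_irreducible S -> zariski_closed Z ->
  (forall x, S x -> Z x \/ x \in s) ->
  included S Z \/ exists a, included S (fun x => x = a).
Proof.
move=> irrS; have [S0 splitS] := irrS; elim: s Z => [|a s IH] Z cZ h.
  by left=> x /h[].
have ca := zariski_closed1 a.
have [x /h||] := IH _ (zariski_closedU cZ ca).
- by rewrite inE => -[|/orP[/eqP|]]; auto.
- by move/(splitS _ _ cZ ca) => [|Sa]; [left | right; exists a].
- by right.
Qed.

Lemma zariski_irreducible_finite (F : fieldType) (n : nat)
    (S : n.-tuple F -> Prop) (s : seq (n.-tuple F)) :
  zariski_irreducible S -> (forall x, S x -> x \in s) ->
  exists a, included S (fun x => x = a).
Proof.
move=> irrS h; have [[x Sx] _] := irrS.
have [||h'|] // := @zariski_irreducible_seq F n S (fun x => x \in [::]) s irrS.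
- exact: zariski_closed_seq.
- by move=> y /h; right.
- by have := h' _ Sx.
Qed.

Lemma included_point (F : fieldType) (n : nat) (S T : n.-tuple F -> Prop) a :
  included T (fun x => x = a) -> included S T -> (exists x, S x) ->
  included T S.
Proof. by move=> Ta ST [x Sx] y /Ta ->; rewrite -(Ta _ (ST _ Sx)). Qed.

Lemma finite_no_chain (F : fieldType) (n : nat) (X : n.-tuple F -> Prop)
    (s : seq (n.-tuple F)) :
  (forall x, X x -> x \in s) -> ~ has_chain X 1.
Proof.
move=> Xs [Z [Zirr /(_ 0%N isT) [Z01]]]; apply.
have [_ [Z0 _] _] := Zirr 0%N isT; have [_ irr1 Z1X] := Zirr 1%N isT.
have [|a Z1a] := @zariski_irreducible_finite _ _ (Z 1%N) s irr1.
  by move=> x /Z1X /Xs.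
exact: included_point Z1a Z01 Z0.
Qed.

Lemma point_has_chain (F : fieldType) (n : nat) (X : n.-tuple F -> Prop) a :
  X a -> has_chain X 0.
Proof.
move=> Xa; exists (fun _ x => x = a); split=> // i _; split.
- exact: zariski_closed1.
- exact: zariski_irreducible1.
- by move=> x ->.
Qed.

Lemma zariski_closure_min (F : fieldType) (n : nat) (S Z : n.-tuple F -> Prop) :
  zariski_closed Z -> included S Z -> included (zariski_closure S) Z.
Proof. by move=> cZ SZ x; apply. Qed.

Lemma sub_zariski_closure (F : fieldType) (n : nat) (S : n.-tuple F -> Prop) :
  included S (zariski_closure S).
Proof. by move=> x Sx Z _; apply. Qed.

(** * The affine line of points (t, 0, 0) *)

Definition axis_pt (F : fieldType) (t : F) : 3.-tuple F := [tuple t; 0; 0].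

Definition axis (F : fieldType) (p : 3.-tuple F) : Prop := exists t, p = axis_pt t.

(** The restriction of a polynomial function to the axis, as a polynomial in the
    parameter t. *)
Definition axis_restr (F : fieldType) (f : {mpoly F[3]}) : {poly F} :=
  mmap (@polyC F) (tnth [tuple 'X; 0; 0]) f.

Lemma horner_axis_restr (F : fieldType) (f : {mpoly F[3]}) (t : F) :
  (axis_restr f).[t] = f.@[tnth (axis_pt t)].
Proof.
rewrite /axis_restr /meval /mmap horner_sum; apply: eq_bigr => m _.
rewrite hornerCM /mmap1 horner_prod; congr (_ * _); apply: eq_bigr => i _.
rewrite horner_exp; congr (_ ^+ _).
by case: i => [[|[|[|//]]] ?]; rewrite /tnth /= ?hornerX ?hornerC.
Qed.

Lemma axis_pt_inj (F : fieldType) : injective (@axis_pt F).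
Proof. by move=> t u /(congr1 (fun p => tnth p 0)). Qed.

Lemma zariski_closed_axis (F : fieldType) : zariski_closed (@axis F).
Proof.
exists (fun f => f = 'X_1 \/ f = 'X_(@ord_max 2)) => x; split.
  by move=> [t ->] f [] ->; rewrite mevalXU.
move=> h; exists (tnth x 0); apply: eq_from_tnth => i.
have := (h _ (or_introl erefl), h _ (or_intror erefl)); rewrite !mevalXU.
case=> h1 h2; case: i => [[|[|[|//]]] ?].
- by rewrite [RHS]/=; congr tnth; apply/val_inj.
- by rewrite -[RHS]h1; congr tnth; apply/val_inj.
- by rewrite -[RHS]h2; congr tnth; apply/val_inj.
Qed.

Lemma vanishes_on_axis (F : closedFieldType) (C : 3.-tuple F -> Prop) f :
  included C (@axis F) -> included (@axis F) C ->
  vanishes_on C f <-> axis_restr f = 0.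
Proof.
move=> CL LC; split=> [h|h x /CL[t ->]].
  apply/eqP; apply: contraT => /closed_nonrootP[t]; rewrite rootE.
  by rewrite horner_axis_restr h ?eqxx //; apply: LC; exists t.
by rewrite -horner_axis_restr h horner0.
Qed.

(** All the solutions of t^n = c are listed; the list may repeat them. *)
Definition nth_roots (F : closedFieldType) (n : nat) (c : F) : seq F :=
  sval (closed_field_poly_normal ('X^n - c%:P)).

Lemma poly_roots_mem (F : closedFieldType) (p : {poly F}) (t : F) :
  p != 0 -> root p t -> t \in sval (closed_field_poly_normal p).
Proof.
move=> p0; case: closed_field_poly_normal => s /= ->.
by rewrite rootZ ?lead_coef_eq0 // root_prod_XsubC.
Qed.

Lemma mem_nth_roots (F : closedFieldType) (n : nat) (c t : F) :
  (0 < n)%N -> t ^+ n = c -> t \in nth_roots n c.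
Proof.
move=> n0 tn; apply: poly_roots_mem; last first.
  by rewrite rootE !hornerE tn subrr.
by rewrite -size_poly_gt0 size_XnsubC.
Qed.

(** A closed set that does not contain the axis satisfies an equation f = 0
    whose restriction to the axis is a nonzero polynomial in one variable. *)
Lemma closed_in_axis (F : closedFieldType) (W : 3.-tuple F -> Prop) :
  zariski_closed W ->
  included (@axis F) W \/
  exists s : seq (3.-tuple F), forall t, W (axis_pt t) -> axis_pt t \in s.
Proof.
move=> [I WP]; have [h|h] := classic (forall f, I f -> axis_restr f = 0).
  left=> _ [t ->]; apply/WP => f /h f0.
  by rewrite -horner_axis_restr f0 horner0.
right; have [f nf] := not_all_ex_not _ _ h.
have [If /eqP f0] := imply_to_and _ _ nf.
exists (map (@axis_pt F) (sval (closed_field_poly_normal (axis_restr f)))).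
move=> t /WP/(_ f If); rewrite -horner_axis_restr => ft.
by apply/map_f/poly_roots_mem => //; apply/eqP.
Qed.

Lemma axis_infinite (F : closedFieldType) (s : seq (3.-tuple F)) :
  ~ included (@axis F) (fun x => x \in s).
Proof.
move=> h; pose q : {poly F} := \prod_(p <- s) ('X - (tnth p 0)%:P).
have /closed_nonrootP[t] : q != 0 by rewrite monic_neq0 ?monic_prod_XsubC.
rewrite /q -(big_map (fun p => tnth p 0) xpredT (fun c => 'X - c%:P)).
rewrite root_prod_XsubC => /negP; apply.
have ts : axis_pt t \in s by apply: h; exists t.
by have := map_f (fun p => tnth p 0) ts.
Qed.

Lemma zariski_irreducible_axis (F : closedFieldType) :
  zariski_irreducible (@axis F).
Proof.
split=> [|Z Z' cZ cZ' h]; first by exists (axis_pt 0), 0.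
have [|[s Zs]] := closed_in_axis cZ; first by left.
have [|[s' Zs']] := closed_in_axis cZ'; first by right.
case: (@axis_infinite F (s ++ s')) => _ [t ->]; rewrite mem_cat.
have /h : axis (axis_pt t) by exists t.
by case=> [/Zs|/Zs'] ->; rewrite ?orbT.
Qed.

Lemma zariski_irreducible_in_axis (F : closedFieldType)
    (S : 3.-tuple F -> Prop) : zariski_irreducible S -> zariski_closed S ->
  included S (@axis F) ->
  included (@axis F) S \/ exists a, included S (fun x => x = a).
Proof.
move=> irrS cS SL; have [|[s Ss]] := closed_in_axis cS; first by left.
by right; apply: (@zariski_irreducible_finite _ _ _ s) => // x Sx;
  have [t xE] := SL _ Sx; move: Sx; rewrite xE; apply: Ss.
Qed.

(** The largest set of the chain lies in the axis or is a point, and a proper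
    irreducible closed subset of the axis is a point. *)
Lemma axis_no_chain2 (F : closedFieldType) (X : 3.-tuple F -> Prop)
    (s : seq (3.-tuple F)) :
  (forall x, X x -> axis x \/ x \in s) -> ~ has_chain X 2.
Proof.
move=> Xs [Z [Zirr Zlt]].
have [_ [Z0 _] _] := Zirr 0%N isT; have [c1 irr1 Z1X] := Zirr 1%N isT.
have [c2 irr2 Z2X] := Zirr 2%N isT.
have [Z01 nZ10] := Zlt 0%N isT; have [Z12 nZ21] := Zlt 1%N isT.
have [|x /Z2X /Xs //|Z2L|[a Z2a]] :=
    @zariski_irreducible_seq F _ (Z 2%N) (@axis F) s irr2.
- exact: zariski_closed_axis.
- have [|LZ1|[a Z1a]] := zariski_irreducible_in_axis irr1 c1.
  + by move=> x /Z12 /Z2L.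
  + by apply: nZ21 => x /Z2L /LZ1.
  by apply: nZ10; apply: included_point Z1a Z01 Z0.
by apply: nZ21; apply: included_point Z2a Z12 _; case: irr1.
Qed.

Lemma axis_has_chain (F : closedFieldType) (X : 3.-tuple F -> Prop) :
  included (@axis F) X -> has_chain X 1.
Proof.
move=> LX; exists (fun i => if i == 0%N then fun x => x = axis_pt 0 else @axis F).
split=> [[|i] _ /=|[|//] _ /=]; split.
- exact: zariski_closed1.
- exact: zariski_irreducible1.
- by move=> _ ->; apply: LX; exists 0.
- exact: zariski_closed_axis.
- exact: zariski_irreducible_axis.
- exact: LX.
- by move=> _ ->; exists 0.
move=> h; have /axis_pt_inj /eqP := h (axis_pt 1) (ex_intro _ 1 erefl).
by rewrite oner_eq0.
Qed.

Lemma axis_is_curve (F : closedFieldType) : is_curve (@axis F).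
Proof.
split; [exact: zariski_closed_axis | exact: zariski_irreducible_axis | split].
  exact: axis_has_chain.
by apply: (@axis_no_chain2 _ _ [::]) => x; left.
Qed.

(** The valuation at the point at infinity of the axis: a polynomial in t has
    there a pole whose order is its degree. *)
Definition axis_infinity (F : fieldType) (f : {mpoly F[3]}) : int :=
  - (size (axis_restr f)).-1%:Z.

Lemma axis_ideal_point (F : closedFieldType) (C : 3.-tuple F -> Prop) :
  included C (@axis F) -> included (@axis F) C ->
  is_ideal_point C (@axis_infinity F).
Proof.
move=> CL LC; have van f := vanishes_on_axis f CL LC.
have restrM f g : axis_restr (f * g) = axis_restr f * axis_restr g.
  by rewrite /axis_restr rmorphM.
have restrD f g : axis_restr (f + g) = axis_restr f + axis_restr g.
  by rewrite /axis_restr rmorphD.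
have restrC c : axis_restr c%:MP = c%:P by rewrite /axis_restr mmapC.
have restrX : axis_restr 'X_0 = 'X :> {poly F} by rewrite /axis_restr mmapX mmap1U.
have nzP f : ~ vanishes_on C f <-> axis_restr f != 0.
  by rewrite van; split=> [/eqP|/eqP].
split; last first.
  exists 0; rewrite nzP restrX polyX_eq0 /axis_infinity restrX size_polyX.
  by [].
split.
- move=> f g /van; rewrite /axis_restr rmorphB /= => /eqP.
  by rewrite subr_eq0 /axis_infinity /axis_restr => /eqP ->.
- move=> f g /nzP f0 /nzP g0; rewrite /axis_infinity restrM size_mul //.
  move: f0 g0; rewrite -!size_poly_gt0.
  case: (size _) => // m _; case: (size _) => // k _.
  by rewrite addSn addnS /= PoszD opprD.
- move=> f g /nzP f0 /nzP g0 /nzP; rewrite /axis_infinity restrD => h0.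
  have := size_polyD (axis_restr f) (axis_restr g).
  move: f0 g0 h0; rewrite -!size_poly_gt0.
  case: (size _) => // m _; case: (size _) => // k _; case: (size _) => // l _ /=.
  rewrite maxnSS ltnS leq_max ge_min !lerN2 !lez_nat orbC.
  by case/orP=> ->; rewrite ?orbT.
- by move=> c c0; rewrite /axis_infinity restrC size_polyC c0.
have restr1 : axis_restr 1 = 1 :> {poly F} by rewrite -mpolyC1 restrC.
exists 1, 'X_0; split.
- by rewrite nzP restr1 oner_eq0.
- by rewrite nzP restrX polyX_eq0.
by rewrite /axis_infinity restr1 restrX size_polyX size_poly1.
Qed.

(** * The variety of characters *)

Lemma reducible_finite (F : closedFieldType) : exists s : seq (3.-tuple F),
  forall p, X_M p -> irr_char_M p \/ p \in s.
Proof.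
exists [seq [tuple a + a^-1; b + b^-1; a * b + (a * b)^-1]
         | a <- nth_roots 26 1, b <- nth_roots 26 1].
move=> p /char_variety_cases[|[a [b [a1 b1 ->]]]]; [by left | right].
by apply: allpairs_f; apply: mem_nth_roots.
Qed.

Lemma char_variety_finite (F : closedFieldType) : (2 : F) != 0 ->
  exists s : seq (3.-tuple F), forall p, X_M p -> p \in s.
Proof.
move=> two0; have [s sP] := reducible_finite F.
pose ys := nth_roots 2 2 ++ nth_roots 12 1 : seq F.
pose xs y := nth_roots 2 1 ++ nth_roots 2 (2 * (1 - y ^+ 2)) : seq F.
pose zs y := 0 :: nth_roots 2 (6 * y ^+ 10) : seq F.
exists (s ++ flatten [seq [seq [tuple x; y; z] | x <- xs y, z <- zs y] | y <- ys]).
move=> p /sP; rewrite mem_cat => -[|-> //].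
move=> /irr_char_coef[x [y [z [-> r1 r2]]]]; apply/orP; right.
have yxz : [/\ y \in ys, x \in xs y & z \in zs y].
  rewrite /ys /xs /zs !mem_cat inE.
  have [[hy -> hx]|[hy hx hz]] := coef_solutions two0 r1 r2.
    by rewrite eqxx (mem_nth_roots _ hy) // (mem_nth_roots _ hx).
  rewrite (mem_nth_roots _ hy) // (mem_nth_roots _ hx) //.
  by rewrite (mem_nth_roots _ hz) // !orbT.
have [yy xx zz] := yxz.
apply/flattenP; eexists; first by apply: map_f yy.
exact: allpairs_f.
Qed.

(** The solutions off the axis are among the points (0, y, 0) with
    y^4 + y^2 + 1 = 0; such a y is a sixth root of unity. *)
Lemma irr_char_char2 (F : closedFieldType) : (2 : F) = 0 ->
  exists s : seq (3.-tuple F), forall p, irr_char_M p -> axis p \/ p \in s.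
Proof.
move=> two0; exists [seq [tuple 0; y; 0] | y <- nth_roots 6 1].
move=> p /irr_char_coef[x [y [z [-> r1 r2]]]].
have [-> [->|[-> y6]]] := coef_solutions_char2 two0 r1 r2; first by left; exists x.
by right; apply: map_f; apply: mem_nth_roots.
Qed.

Lemma axis_irr_char (F : closedFieldType) (t : F) : (2 : F) = 0 -> t != 0 ->
  irr_char_M (axis_pt t).
Proof.
move=> two0 t0; apply: irr_char_intro.
- congr (_, _, _); first (transitivity (- 2 * t); [by ring | by rewrite two0; ring]).
    by transitivity (2 * (t ^+ 2 - 1)); [by ring | by rewrite two0; ring].
  by ring.
- by congr (_, _, _); ring.
rewrite (_ : _ - _ = t ^+ 2 - 2 * 2); last by ring.
by rewrite two0 mul0r subr0 expf_neq0.
Qed.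

(** Only (0, 0, 0) could be missing, and the axis is irreducible and is not a
    point. *)
Lemma axis_in_Xirr (F : closedFieldType) : (2 : F) = 0 ->
  included (@axis F) (@Xirr_M F).
Proof.
move=> two0 x ax Z cZ irrZ; have [_ splitL] := zariski_irreducible_axis F.
have [_ [t ->]|LZ|L0] := splitL Z _ cZ (zariski_closed1 (axis_pt 0)).
- have [->|t0] := eqVneq t 0; [by right | left].
  exact/irrZ/axis_irr_char.
- exact: LZ.
have /axis_pt_inj/eqP := L0 (axis_pt 1) (ex_intro _ 1 erefl).
by rewrite oner_eq0.
Qed.

(** The point (1, sqrt 2, 0), where the commutator has trace 1. *)
Lemma exists_irr_char (F : closedFieldType) : (2 : F) != 0 ->
  exists p : 3.-tuple F, irr_char_M p.
Proof.
move=> two0.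
have [//|y] := solve_monicpoly (fun i => [:: 2; 0 : F]`_i) (n := 2).
rewrite !big_ord_recl big_ord0 /= expr0 mulr1 mul0r !addr0 => y2.
exists [tuple 1; y; 0]; apply: irr_char_intro.
- congr (_, _, _); try by ring.
    by transitivity (y ^+ 2 - 2); [ring | rewrite y2 subrr].
- have y4 : y ^+ 4 = 4 by rewrite (exprM y 2 2) y2; ring.
  have y6 : y ^+ 6 = 8 by rewrite (exprM y 2 3) y2; ring.
  congr (_, _, _); last 1 first.
  + transitivity (4 * y ^+ 4 - y ^+ 6 - 4 * y ^+ 2); first by ring.
    by rewrite y2 y4 y6; ring.
  + by transitivity (y * (y ^+ 4 - 3 * y ^+ 2 + 2)); [ring | rewrite y2 y4; ring].
  by ring.
rewrite (_ : _ - _ = y ^+ 2 - 3); last by ring.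
by rewrite y2 (_ : _ - _ = -1) ?oppr_eq0 ?oner_eq0 //; ring.
Qed.

Lemma closure_of_finite (F : fieldType) (n : nat) (S : n.-tuple F -> Prop)
    (s : seq (n.-tuple F)) :
  (forall x, S x -> x \in s) -> forall x, zariski_closure S x -> x \in s.
Proof. exact: zariski_closure_min (zariski_closed_seq s). Qed.

Lemma irr_char_sub (F : fieldType) (p : 3.-tuple F) : irr_char_M p -> X_M p.
Proof. by move=> [rho [rep _ pE]]; exists rho. Qed.

Theorem mainTheorem6 (F : closedFieldType) :
  [/\ (* (i) *)
      2%N \notin [pchar F] ->
        (exists s : seq (3.-tuple F),
           forall C : 3.-tuple F -> Prop, is_component (@X_M F) C ->
             (exists x, C x /\ irr_char_M x) -> forall x, C x -> x \in s) /\
        has_dim (@Xirr_M F) 0,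
      (* (ii) *)
      2%N \in [pchar F] ->
        (exists C : 3.-tuple F -> Prop,
           is_curve C /\ included C (@Xirr_M F)) /\
        has_dim (@Xirr_M F) 1
    & (* in particular *)
      forall C : 3.-tuple F -> Prop, is_curve C -> included C (@X_M F) ->
        2%N \in [pchar F] /\ exists v, is_ideal_point C v].
Proof.
have pcharE : (2%N \in [pchar F]) = ((2 : F) == 0) by rewrite inE.
rewrite pcharE; split=> [two0|/eqP two0|C [cC irrC [chC _]] CX].
- have [s sP] := char_variety_finite two0.
  split; first by exists s => C [_ CX _] _ x /CX /sP.
  have [p irrp] := exists_irr_char two0.
  split; first exact: point_has_chain (sub_zariski_closure irrp).
  apply: finite_no_chain (closure_of_finite (s := s) _) => x /irr_char_sub.
  exact: sP.
- have LX := axis_in_Xirr two0.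
  split; first by exists (@axis F); split; first exact: axis_is_curve.
  split; first exact: axis_has_chain.
  have [s sP] := irr_char_char2 two0; apply: (@axis_no_chain2 _ _ s).
  apply: zariski_closure_min sP.
  exact: zariski_closedU (zariski_closed_axis F) (zariski_closed_seq s).
have nfin (s : seq (3.-tuple F)) : ~ (forall x, C x -> x \in s).
  by move=> Cs; case: (finite_no_chain Cs chC).
have [two0|two0] := eqVneq (2 : F) 0; last first.
  have [s sP] := char_variety_finite two0.
  by case: (nfin s) => x /CX /sP.
split=> //; exists (@axis_infinity F).
have npt a : ~ included C (fun x => x = a).
  by move=> h; apply: (nfin [:: a]) => x /h ->; rewrite inE.
have [s sP] := irr_char_char2 two0; have [s' sP'] := reducible_finite F.
have [x /CX /sP'|CL|[a /npt//]] :=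
  zariski_irreducible_seq (s := s ++ s') irrC (zariski_closed_axis F).
  rewrite mem_cat => -[/sP[|->]|->]; rewrite ?orbT; auto.
have [LC|[a /npt//]] := zariski_irreducible_in_axis irrC cC CL.
exact: axis_ideal_point.
Qed.
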